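(* Let $\mathcal I$ be a canonical instance, and run the following procedure (Algorithm 1). Start with all bundles empty and all agents present. For $h=1,\dots,m$ in turn: let $\mathcal N_h$ be the set of agents $a_{i,j}$ still present with $v_{i,j}(e_h)\le w_i$; choose $a_{i,j}\in\mathcal N_h$ minimizing $v_{i,j}(e_h)$, breaking ties in favor of the smallest weight and remaining ties arbitrarily; add $e_h$ to $A_{i,j}$; if now $v_{i,j}(A_{i,j})\ge 3w_i$, remove $a_{i,j}$ from the set of present agents. Then, for every resolution of the remaining ties, $\mathcal N_h\neq\emptyset$ at every step $h$ (so every item is allocated), and the resulting allocation satisfies $v_{i,j}(A_{i,j})\le 3w_i=3\,\mathsf{WMMS}_{i,j}$ for every agent $a_{i,j}$; i.e. it is a $3$-WMMS allocation.
   Context: Chore-allocation instance: agents, a finite set $\mathcal M=\{e_1,\dots,e_m\}$ of indivisible items, positive weights, additive cost functions $v:2^{\mathcal M}\to\mathbb R_{\ge0}$. An allocation is an ordered partition of $\mathcal M$ into one (possibly empty) bundle per agent. The weighted maximin share of agent $a$ with weight $w_a$ and cost $v_a$ is $\mathsf{WMMS}_a=w_a\min_{\text{allocations }(B_b)_b}\max_{b}\frac{v_a(B_b)}{w_b}$; an allocation is $\beta$-WMMS if each agent's own bundle costs her at most $\beta\,\mathsf{WMMS}$. An instance is canonical if: (i) $\max$ weight is $w_1$, weights sum to $1$, and every weight equals $w_1/2^p$ for some nonnegative integer $p$; (ii) every agent's total cost $v(\mathcal M)=1$, and every single-item cost is either $0$ or $w_1/2^p$ for some nonnegative integer $p$;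 (iii) every agent has $v(e_1)\ge v(e_2)\ge\cdots\ge v(e_m)$; (iv) every agent's $\mathsf{WMMS}$ equals her weight. Group notation: agents of a canonical instance are partitioned into groups $G_1,\dots,G_k$ by weight, where all agents of $G_i$ have weight $w_i$ and $w_1>w_2>\cdots>w_k$; $G_i=\{a_{i,1},\dots,a_{i,n_i}\}$, and $v_{i,j},A_{i,j},\mathsf{WMMS}_{i,j}$ denote the cost function, bundle and WMMS of $a_{i,j}$. *)

(* Defs.v *)
From mathcomp Require Import all_boot all_order all_algebra.
Set Implicit Arguments. Unset Strict Implicit. Unset Printing Implicit Defensive.
Import Order.TTheory GRing.Theory Num.Theory.
Local Open Scope ring_scope.

(* Agents form a finite type [A]; items are e_1,...,e_m, represented by 'I_m
   (item e_{h+1} is the ordinal h).  [w a] is the weight of agent a and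
   [v a e] the cost of item e for agent a; the additive cost of a bundle B is
   [cost v a B] = \sum_(e in B) v a e. *)

Section Defs.
Variables (R : realFieldType) (A : finType) (m : nat).
Variables (w : A -> R) (v : A -> 'I_m -> R).

Definition cost (a : A) (B : {set 'I_m}) : R := \sum_(e in B) v a e.

(* allocations: ordered partitions of the items, i.e. maps item -> agent *)
Definition bundle (B : {ffun 'I_m -> A}) (b : A) : {set 'I_m} :=
  [set e | B e == b].

(* max_b v_a(B_b)/w_b  (exact max over the nonempty type A; the neutral
   element is one of the terms, namely the one for b = a) *)
Definition wmax_ratio (a : A) (B : {ffun 'I_m -> A}) : R :=
  \big[Num.max/cost a (bundle B a) / w a]_(b : A) (cost a (bundle B b) / w b).

(* WMMS_a = w_a * min over allocations of the above (exact min; neutral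
   element is the value at the allocation giving everything to a) *)
Definition WMMS (a : A) : R :=
  w a * \big[Num.min/wmax_ratio a [ffun _ => a]]_(B : {ffun 'I_m -> A})
          wmax_ratio a B.

Definition canonical_instance : Prop :=
  (forall a, 0 < w a) /\
  (forall a e, 0 <= v a e) /\
  exists w1 : R,
    [/\
        ((exists a1, w a1 = w1) /\ (forall a, w a <= w1)) /\
        \sum_(a : A) w a = 1 /\
        (forall a, exists p : nat, w a = w1 / 2 ^+ p),
        ((forall a, cost a [set: 'I_m] = 1) /\
         (forall a e, v a e = 0 \/ exists p : nat, v a e = w1 / 2 ^+ p)),
        (forall a (e e' : 'I_m), (e <= e')%N -> v a e' <= v a e)
      &
        (forall a, WMMS a = w a)].

(* ---- Algorithm 1 ----
   A run is described by the choice function [c : 'I_m -> A]: item e is given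
   to agent [c e].  Only the values of c on items processed so far matter. *)

Definition bundle_before (c : 'I_m -> A) (h : nat) (a : A) : {set 'I_m} :=
  [set e : 'I_m | (e < h)%N && (c e == a)].

Definition present (c : 'I_m -> A) (h : nat) (a : A) : bool :=
  [forall e : 'I_m, ((e < h)%N && (c e == a)) ==>
                    (cost a (bundle_before c e.+1 a) < 3 * w a)].

Definition N_set (c : 'I_m -> A) (e : 'I_m) : {set A} :=
  [set a | present c e a && (v a e <= w a)].

Definition valid_step (c : 'I_m -> A) (e : 'I_m) : Prop :=
  c e \in N_set c e /\
  forall b, b \in N_set c e ->
    v (c e) e <= v b e /\ (v b e = v (c e) e -> w (c e) <= w b).

End Defs.

(* Main.v *)
Require Import Defs.
From mathcomp Require Import all_boot all_order all_algebra.
From mathcomp Require Import lra.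
Import Order.TTheory GRing.Theory Num.Theory.
Local Open Scope ring_scope.

(** Call an agent heavier than [b] if its weight exceeds [w b], and charge every
    allocated item at its cost for the agent receiving it.  The key invariant is
    that, for each agent [b], the items that are too expensive for [b] (cost
    above [w b]) are charged in total at most 3/2 of the weight of the agents
    heavier than [b].  A saturated agent is charged at least three times its
    weight, so the agents heavier than [b] cannot all be saturated while the
    current item is too expensive for [b].

    To preserve the invariant, let [a] be a heaviest present agent.  Items too
    expensive for [a] are covered by induction.  Every other item was affordable
    for [a], so it is charged at most its cost for [a], and at most half of that
    when its receiver is heavier than [a], by the tie-breaking rule and
    dyadicity.  As the agents heavier than [a] are saturated, at least half of
    their charge comes from items of the second kind, and this factor 2 pays for
    the other half: the total charge is at most the total cost for [a] of the
    items allocated so far.  In particular the charge never exceeds 1, so not all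
    agents get saturated.  If the last of these items, hence each of them, is too
    expensive for [b], that cost is bounded by packing the items into bins of
    capacities [w]: items costing [a] more than [w b] fit in the bins larger than
    [w b], while the others cost at most [w b] each, that is, at most half of
    what each of them costs [b]. *)

(** * Dyadic fractions of a common unit *)

Lemma dyadic_gap (R : realFieldType) (u : R) (p q : nat) :
  0 < u -> u / 2 ^+ p < u / 2 ^+ q -> 2 * (u / 2 ^+ p) <= u / 2 ^+ q.
Proof.
move=> u_gt0; rewrite ltr_pM2l // ltf_pV2 ?posrE ?exprn_gt0 // => lt_qp.
have {}lt_qp : (q < p)%N by move: lt_qp; rewrite ltr_eXn2l ?ltr1n.
rewrite mulrCA ler_pM2l // -(subnKC lt_qp) exprD exprS !invfM !mulrA.
rewrite divff ?pnatr_eq0 //.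
rewrite mul1r ler_piMr ?invr_ge0 ?exprn_ge0 //.
by rewrite invf_le1 ?exprn_gt0 // exprn_ege1 // ler1n.
Qed.

Lemma dyadic_dvd (R : realFieldType) (u : R) (p q : nat) :
  0 < u -> u / 2 ^+ p <= u / 2 ^+ q ->
  exists k : nat, u / 2 ^+ q = k%:R * (u / 2 ^+ p).
Proof.
move=> u_gt0; rewrite ler_pM2l // lef_pV2 ?posrE ?exprn_gt0 // => le_qp.
have {}le_qp : (q <= p)%N by move: le_qp; rewrite ler_eXn2l ?ltr1n.
exists (2 ^ (p - q))%N.
rewrite natrX mulrCA; congr (_ * _).
by rewrite -{2}(subnKC le_qp) exprD invfM mulrCA divff ?mulr1 ?expf_neq0 ?pnatr_eq0.
Qed.

Section Canonical.

Variables (R : realFieldType) (A : finType) (m : nat).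
Variables (w : A -> R) (v : A -> 'I_m -> R) (w1 : R).
Hypothesis w_gt0 : forall a, 0 < w a.
Hypothesis v_ge0 : forall a e, 0 <= v a e.
Hypothesis w_dyadic : forall a, exists p : nat, w a = w1 / 2 ^+ p.
Hypothesis v_dyadic :
  forall a e, v a e = 0 \/ exists p : nat, v a e = w1 / 2 ^+ p.
Hypothesis v_sorted : forall a (e e' : 'I_m), (e <= e')%N -> v a e' <= v a e.

(** Otherwise all the finitely many ratios exceed 1, so their minimum does, and [WMMS] would exceed
    [w a]. *)
Lemma WMMS_packing a : WMMS w v a = w a ->
  exists B : {ffun 'I_m -> A}, forall b, cost v a (bundle B b) <= w b.
Proof.
move=> wmmsE.
have [/existsP[B leB]|/existsPn gtB] :=
    boolP [exists B : {ffun 'I_m -> A}, wmax_ratio w v a B <= 1].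
  exists B => b; rewrite -[w b]mul1r -ler_pdivrMr //; apply: le_trans leB.
  exact: le_bigmax.
suff : w a < WMMS w v a by rewrite wmmsE ltxx.
rewrite /WMMS -{1}[w a]mulr1 ltr_pM2l //.
by apply: lt_bigmin => [|B _]; rewrite ltNge gtB.
Qed.

Lemma w1_gt0 (a : A) : 0 < w1.
Proof.
have [p wE] := w_dyadic a; move: (w_gt0 a).
by rewrite wE pmulr_lgt0 // invr_gt0 exprn_gt0.
Qed.

Lemma expensive_gap {b e} : w b < v b e -> 2 * w b <= v b e.
Proof.
have [p ->] := w_dyadic b; have [-> | [q ->]] := v_dyadic b e.
  by rewrite ltNge divr_ge0 ?exprn_ge0 // ltW // (w1_gt0 b).
exact/dyadic_gap/(w1_gt0 b).
Qed.

Lemma cost_gap {a b e} : v a e < v b e -> 2 * v a e <= v b e.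
Proof.
have [-> _ | [p ->]] := v_dyadic a e; first by rewrite mulr0.
have [-> | [q ->]] := v_dyadic b e.
  by rewrite ltNge divr_ge0 ?exprn_ge0 // ltW // (w1_gt0 b).
exact/dyadic_gap/(w1_gt0 b).
Qed.

Lemma le_sum_sub (I : finType) (P Q : pred I) (F : I -> R) :
  (forall i, P i -> Q i) -> (forall i, 0 <= F i) ->
  \sum_(i | P i) F i <= \sum_(i | Q i) F i.
Proof.
move=> PQ F_ge0; rewrite [leRHS](bigID P) /= -[leLHS]addr0.
apply: lerD; last by apply: sumr_ge0.
rewrite le_eqVlt; apply/orP; left; apply/eqP/eq_bigl => i.
by apply/idP/andP => [Pi|[]//]; rewrite Pi PQ.
Qed.

Definition weight_above (x : R) : R := \sum_(a | x < w a) w a.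

Hypothesis packing : forall a,
  exists B : {ffun 'I_m -> A}, forall b, cost v a (bundle B b) <= w b.

Lemma cost_above a x : \sum_(e | x < v a e) v a e <= weight_above x.
Proof.
have [B leB] := packing a.
apply: (@le_trans _ _ (\sum_(e | x < w (B e)) v a e)).
  apply: le_sum_sub => // e lt_x; apply: lt_le_trans lt_x _.
  apply: le_trans (leB (B e)).
  rewrite /cost (bigD1 e) ?inE //= lerDl.
  by apply: sumr_ge0.
rewrite (partition_big B (fun b => x < w b)) //=.
apply: ler_sum => b lt_xb; apply: le_trans (leB b).
by apply: le_sum_sub => // e /andP[_]; rewrite inE.
Qed.

(** Positivity makes [3 * W <= 3 / 2 * W] absurd for [W = weight_above (w b)]. *)
Lemma weight_above_gt0 {b e} : w b < v b e -> 0 < weight_above (w b).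
Proof.
move=> lt_wv; apply: lt_le_trans (cost_above b (w b)).
rewrite (bigD1 e) //=; apply: ltr_pwDl; first exact: lt_trans lt_wv.
exact: sumr_ge0.
Qed.

Lemma cost_ge_mono a (B B' : {set 'I_m}) :
  B \subset B' -> cost v a B <= cost v a B'.
Proof. by move=> /subsetP sBB'; apply: le_sum_sub => // e /sBB'. Qed.

(** * Saturation and the charge invariant *)

Section Run.

Variable c : 'I_m -> A.

Lemma present_mono {s t a} : (s <= t)%N ->
  present w v c t a -> present w v c s a.
Proof.
move=> le_st /forallP pr; apply/forallP => e; apply/implyP => /andP[lt_es ce].
by have /implyP := pr e; apply; rewrite ce (leq_trans lt_es).
Qed.

Lemma saturated_cost t a : ~~ present w v c t a ->
  3 * w a <= cost v a (bundle_before c t a).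
Proof.
move=> /forallPn[e]; rewrite negb_imply -leNgt => /andP[/andP[lt_et _] sat].
apply: le_trans sat _; apply: cost_ge_mono; apply/subsetP => e'.
by rewrite !inE => /andP[lt_e'e ->]; rewrite (leq_trans lt_e'e).
Qed.

Lemma saturated_charge t (P : pred A) :
  (forall a, P a -> ~~ present w v c t a) ->
  3 * (\sum_(a | P a) w a) <= \sum_(e : 'I_m | (e < t)%N && P (c e)) v (c e) e.
Proof.
move=> sat; rewrite (partition_big c P) /=; last by move=> e /andP[].
rewrite mulr_sumr; apply: ler_sum => a Pa.
apply: le_trans (saturated_cost t a (sat a Pa)) _; rewrite /cost.
rewrite [leRHS](eq_bigr (v a)); last by move=> e /andP[_ /eqP ->].
apply: le_sum_sub => // e; rewrite inE => /andP[-> /eqP ->].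
by rewrite Pa eqxx.
Qed.

Definition expensive_charge_bound t := forall b,
  \sum_(e : 'I_m | (e < t)%N && (w b < v b e)) v (c e) e
    <= 3 / 2 * weight_above (w b).

Lemma heaviest_present_in_N (h : 'I_m) a :
  expensive_charge_bound h -> present w v c h a ->
  (forall b, w a < w b -> ~~ present w v c h b) -> a \in N_set w v c h.
Proof.
move=> bound pr_a sat; rewrite inE pr_a /= leNgt; apply/negP => exp_a.
have := weight_above_gt0 exp_a.
have := saturated_charge h (fun b => w a < w b) sat.
(* Costs are sorted, so all earlier items were too expensive for [a] too, and [bound a] covers the
   whole charge of the heavier agents. *)
have le_charge : \sum_(e : 'I_m | (e < h)%N && (w a < w (c e))) v (c e) e
    <= \sum_(e : 'I_m | (e < h)%N && (w a < v a e)) v (c e) e.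
  apply: le_sum_sub => // e /andP[lt_eh _]; rewrite lt_eh.
  exact: lt_le_trans exp_a (v_sorted a _ _ (ltnW lt_eh)).
have := bound a; rewrite -/(weight_above (w a)); lra.
Qed.

Lemma heaviest_present t a0 : present w v c t a0 ->
  exists2 a, present w v c t a & forall b, w a < w b -> ~~ present w v c t b.
Proof.
move=> pr0; case: (arg_maxP w pr0) => a pr_a max_a.
exists a => // b lt_ab; apply: contraTN lt_ab => pr_b.
by rewrite -leNgt; apply: max_a.
Qed.

Lemma charge_le_cost (s : 'I_m) : expensive_charge_bound s ->
  (forall e : 'I_m, (e <= s)%N -> valid_step w v c e) ->
  exists a, \sum_(e : 'I_m | (e <= s)%N) v (c e) e
              <= \sum_(e : 'I_m | (e <= s)%N) v a e.
Proof.
move=> bound valid.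
have [] := heaviest_present s (c s).
  by have [/[!inE]/andP[]] := valid s (leqnn s).
move=> a pr_a sat.
have a_in_N := heaviest_present_in_N s a bound pr_a sat.
exists a.
set H := fun e => w a < w (c e).
set X := fun e => w a < v a e.
have charge_heavy_exp :
    \sum_(e : 'I_m | (e <= s)%N && (H e && X e)) v (c e) e
      <= 3 / 2 * weight_above (w a).
  apply: le_trans (bound a); apply: le_sum_sub => // e /and3P[le_es _ Xe].
  (* [bound] counts only items before [s]; item [s] itself is not in [X], being affordable for
     [a]. *)
  rewrite [w a < _]Xe andbT ltn_neqAle le_es andbT.
  apply: contraTneq Xe => /val_inj ->; rewrite -leNgt.
  by move: a_in_N; rewrite inE => /andP[].
have charge_heavy :
    3 * weight_above (w a) <= \sum_(e : 'I_m | (e <= s)%N && H e) v (c e) e.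
  apply: le_trans (saturated_charge s (fun b => w a < w b) sat) _.
  by apply: le_sum_sub => // e /andP[/ltnW -> He].
have splitH : \sum_(e : 'I_m | (e <= s)%N && H e) v (c e) e =
    \sum_(e : 'I_m | (e <= s)%N && (H e && X e)) v (c e) e +
    \sum_(e : 'I_m | (e <= s)%N && (H e && ~~ X e)) v (c e) e.
  by rewrite (bigID X) /=; congr (_ + _); apply: eq_bigl => e; rewrite andbA.
(* The last summand on the left is at least [3 / 2 * weight_above (w a)], the last one on the right
   at most that, so both may be dropped. With them the inequality holds item by item. *)
suff : \sum_(e : 'I_m | (e <= s)%N) v (c e) e +
       \sum_(e : 'I_m | (e <= s)%N && (H e && ~~ X e)) v (c e) e <=
       \sum_(e : 'I_m | (e <= s)%N) v a e +
       \sum_(e : 'I_m | (e <= s)%N && (H e && X e)) v (c e) e by lra.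
rewrite 2!big_mkcondr -2!big_split /=; apply: ler_sum => e le_es.
have [/[!inE]/andP[_ le_vw] opt] := valid e le_es.
have [Xe|] := boolP (X e); rewrite ?andbT ?andbF.
  case: ifP => [_|/negbT]; first by rewrite addr0 lerDr.
  rewrite -leNgt !addr0 => le_wc.
  exact: le_trans le_vw (le_trans le_wc (ltW Xe)).
rewrite -leNgt => le_va.
have a_in : a \in N_set w v c e by rewrite inE le_va (present_mono le_es).
have [le_c tie] := opt a a_in.
case: ifP => [He|_]; last by rewrite !addr0.
(* Equal costs would be a tie, which the lighter agent [a] wins against a heavier receiver. *)
have lt_c : v (c e) e < v a e.
  rewrite lt_neqAle le_c andbT; apply/eqP => /esym /tie.
  by rewrite leNgt -/(H e) He.
by have := cost_gap lt_c; lra.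
Qed.

Lemma expensive_charge t : (t <= m)%N ->
  (forall e : 'I_m, (e < t)%N -> valid_step w v c e) ->
  expensive_charge_bound t.
Proof.
elim: t => [|s IHs] lt_sm valid b.
  by rewrite big_pred0 // mulr_ge0 ?divr_ge0 // sumr_ge0 // => a _; apply: ltW.
have bound : expensive_charge_bound s.
  by apply: IHs => [|e lt_es]; [exact: ltnW | apply/valid/ltnW].
pose s' := Ordinal lt_sm.
have [Xs|cheap] := boolP (w b < v b s'); last first.
  apply: le_trans (bound b); apply: le_sum_sub => // e /andP[].
  rewrite ltnS => le_es Xe; rewrite Xe andbT ltn_neqAle le_es andbT.
  by apply: contraNneq cheap => es; rewrite (_ : s' = e) //; apply: val_inj.
have Xle (e : 'I_m) : (e < s.+1)%N -> w b < v b e.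
  by move=> le_es; apply: lt_le_trans Xs (v_sorted b _ _ _).
have [a le_a] := charge_le_cost s' bound valid.
apply: (@le_trans _ _ (\sum_(e : 'I_m | (e <= s)%N) v (c e) e)).
  by apply: le_sum_sub => // e /andP[].
apply: le_trans le_a _; rewrite (bigID (fun e => w b < v a e)) /=.
(* Large items contribute at most [weight_above (w b)] and small ones at most half of it, whence the
   constant 3/2. *)
have large : \sum_(e < m | (e <= s)%N && (w b < v a e)) v a e
    <= weight_above (w b).
  by apply: le_trans (cost_above a (w b)); apply: le_sum_sub => // e /andP[].
have small : 2 * (\sum_(e < m | (e <= s)%N && ~~ (w b < v a e)) v a e)
    <= weight_above (w b).
  apply: le_trans (cost_above b (w b)).
  apply: (@le_trans _ _ (\sum_(e < m | (e <= s)%N && ~~ (w b < v a e)) v b e)).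
    rewrite mulr_sumr; apply: ler_sum => e /andP[le_es].
    by rewrite -leNgt; have := expensive_gap (Xle e le_es); lra.
  by apply: le_sum_sub => // e /andP[le_es _]; apply: Xle.
lra.
Qed.

(** * Every item finds a receiver *)

Hypothesis w_sum : \sum_(a : A) w a = 1.
Hypothesis v_sum : forall a, cost v a [set: 'I_m] = 1.

Lemma N_set_nonempty (h : 'I_m) :
  (forall e : 'I_m, (e < h)%N -> valid_step w v c e) ->
  exists a, a \in N_set w v c h.
Proof.
move=> valid.
have [/existsP[a0 pr0]|/existsPn sat] := boolP [exists a, present w v c h a].
  have [a pr_a sat] := heaviest_present h a0 pr0; exists a.
  apply: heaviest_present_in_N => //.
  by apply: expensive_charge => //; apply: ltnW.
have := saturated_charge h xpredT (fun a _ => sat a).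
rewrite w_sum mulr1 (eq_bigl (fun e : 'I_m => (e < h)%N)); last first.
  by move=> e; rewrite andbT.
(* [charge_le_cost] needs a last allocated item. Without one the charge is 0, otherwise at most 1;
   full saturation would make it at least 3. *)
case: h valid {sat} => [[|s] lt_hm] valid /=.
  by rewrite big_pred0 // lern0.
pose s' := Ordinal (ltnW lt_hm).
have bound : expensive_charge_bound s'.
  by apply: expensive_charge => [|e lt_es]; [exact: ltnW | apply/valid/ltnW].
have [a le_a] := charge_le_cost s' bound valid.
move=> /le_trans /(_ le_a); have : \sum_(e < m | (e <= s)%N) v a e <= 1.
  by rewrite -(v_sum a); apply: le_sum_sub => // e _; rewrite inE.
move=> /[swap] /le_trans /[apply]; lra.
Qed.

(** * The cost of the final bundles *)

Lemma bundle_before_S (e : 'I_m) a : bundle_before c e.+1 a =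
  if c e == a then e |: bundle_before c e a else bundle_before c e a.
Proof.
apply/setP => e'; rewrite (fun_if (fun B : {set 'I_m} => e' \in B)) !inE ltnS.
have [->|ne_e] := eqVneq e' e; first by rewrite leqnn ltnn; case: eqP.
by rewrite leq_eqVlt (inj_eq val_inj) (negPf ne_e) if_same.
Qed.

Lemma bundle_before0 a : bundle_before c 0 a = set0.
Proof. by apply/setP => e; rewrite !inE. Qed.

(** [present] tests the cost only right after [a] receives an item; in between the bundle does not
    change. *)
Lemma present_cost t a : (t <= m)%N -> present w v c t a ->
  cost v a (bundle_before c t a) < 3 * w a.
Proof.
elim: t => [|s IHs] lt_sm pr.
  by rewrite bundle_before0 /cost big_set0 mulr_gt0.
pose s' := Ordinal lt_sm; rewrite (bundle_before_S s').
have [cs|_] := eqVneq; last by apply: IHs; [exact: ltnW | exact: present_mono pr].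
have /forallP/(_ s')/implyP := pr; rewrite /= ltnSn cs eqxx.
by rewrite (bundle_before_S s') cs eqxx; apply.
Qed.

(* All costs involved are multiples of the cost of the last item, so a sum
   below [3 * w a] stays at most [3 * w a] after adding it. *)
Lemma cost_add_le (e : 'I_m) a : v a e <= w a ->
  cost v a (bundle_before c e a) < 3 * w a ->
  v a e + cost v a (bundle_before c e a) <= 3 * w a.
Proof.
have [-> _ /ltW|[p vE]] := v_dyadic a e; first by rewrite add0r.
have u_gt0 := w1_gt0 a; have [q wE] := w_dyadic a.
have x_gt0 : 0 < v a e by rewrite vE divr_gt0 ?exprn_gt0.
move=> le_vw; have [K wK] : exists k : nat, w a = k%:R * v a e.
  by rewrite vE wE; apply: dyadic_dvd; rewrite // -vE -wE.
have [n ->] : exists n : nat, cost v a (bundle_before c e a) = n%:R * v a e.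
  apply: (big_ind (fun x => exists n : nat, x = n%:R * v a e))
      => [|_ _ [n1 ->] [n2 ->]|e']; first by exists 0%N; rewrite mul0r.
    by exists (n1 + n2)%N; rewrite natrD mulrDl.
  rewrite inE => /andP[/ltnW/v_sorted-/(_ a) + _].
  have [->|[q' ->]] := v_dyadic a e'; first by rewrite leNgt x_gt0.
  by rewrite vE; apply: dyadic_dvd.
rewrite wK mulrA -natrM ltr_pM2r // ltr_nat => lt_n.
by rewrite -{1}[v a e]mul1r -mulrDl nat1r ler_pM2r // ler_nat.
Qed.

Lemma final_cost a : (forall e : 'I_m, valid_step w v c e) ->
  cost v a [set e | c e == a] <= 3 * w a.
Proof.
move=> valid; have <- : bundle_before c m a = [set e | c e == a].
  by apply/setP => e; rewrite !inE ltn_ord.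
suff le_t t : (t <= m)%N -> cost v a (bundle_before c t a) <= 3 * w a.
  exact: le_t.
elim: t => [_|s IHs lt_sm].
  by rewrite bundle_before0 /cost big_set0 mulr_ge0 // ltW.
pose s' := Ordinal lt_sm; rewrite (bundle_before_S s').
have [cs|_] := eqVneq; last by apply/IHs/ltnW.
rewrite /cost big_setU1 ?inE ?ltnn //=.
have [/[!inE]/andP[pr le_vw] _] := valid s'; rewrite cs in pr le_vw.
by apply: (cost_add_le s') => //; apply: present_cost => //; apply: ltnW.
Qed.

End Run.
End Canonical.

Theorem theorem4p1 (R : realFieldType) (A : finType) (m : nat)
    (w : A -> R) (v : A -> 'I_m -> R) :
  canonical_instance w v ->
  (* N_h is nonempty at every step h, for every run of the algorithm so far *)
  (forall (c : 'I_m -> A) (h : 'I_m),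
      (forall e : 'I_m, (e < h)%N -> valid_step w v c e) ->
      exists a, a \in N_set w v c h) /\
  (* every complete run yields a 3-WMMS allocation *)
  (forall c : 'I_m -> A,
      (forall e : 'I_m, valid_step w v c e) ->
      forall a : A,
        cost v a [set e | c e == a] <= 3 * w a /\
        cost v a [set e | c e == a] <= 3 * WMMS w v a).
Proof.
move=> [w_gt0 [v_ge0 [w1 [[_ [w_sum w_dyadic]] [v_sum v_dyadic] v_sorted wmmsE]]]].
split=> [c h valid | c valid a].
  apply: (@N_set_nonempty _ _ _ w v w1) => // a.
  exact: WMMS_packing (wmmsE a).
by rewrite wmmsE; split; apply: (@final_cost _ _ _ w v w1).
Qed.
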